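(* Let $\mathcal{P}\subseteq\mathbb{R}^n_{\geq 0}$ be a symmetric lattice polytope, write $\operatorname{MLP}(\mathcal{P})=\{\lambda_1,\dots,\lambda_k\}$ (distinct elements), and let $s=\sum_{\lambda\in\operatorname{MLP}(\mathcal{P})}s_\lambda\in\mathbb{Z}[x_1,\dots,x_n]$. For $t\in\mathbb{Z}_{>0}$ let $$ts:=\sum_{I} s_{\lambda_I},\qquad \lambda_I:=\sum_{i\in I}\lambda_i,$$ where $I$ ranges over all multisubsets of $\{1,\dots,k\}$ of size $t$ (the sum defining $\lambda_I$ is taken with multiplicity). Suppose that for every $t\in\mathbb{Z}_{>0}$ we have $\operatorname{Newt}(ts)=t\operatorname{Newt}(s)$ and $t\mathcal{P}=\operatorname{Newt}(ts)$, and that $ts$ has saturated Newton polytope for every $t\in\mathbb{Z}_{>0}$. Then $\mathcal{P}$ has the integer decomposition property.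
   Context: A lattice polytope in $\mathbb{R}^n$ is the convex hull of a nonempty finite set of points of $\mathbb{Z}^n$. A polytope $\mathcal{P}\subseteq\mathbb{R}^n$ is symmetric if $\pi\mathcal{P}=\mathcal{P}$ for every permutation $\pi$ of $\{1,\dots,n\}$, acting by permuting coordinates. For $t\in\mathbb{N}$ (positive integers), $t\mathcal{P}=\{tx : x\in\mathcal{P}\}$. $\mathcal{P}$ has the integer decomposition property (IDP) if for every $t\in\mathbb{N}$, every lattice point $x\in t\mathcal{P}\cap\mathbb{Z}^n$ can be written as $x=\sum_{i=1}^t x_i$ with $x_i\in\mathcal{P}\cap\mathbb{Z}^n$ (not necessarily distinct). For a polynomial $f=\sum_\alpha c_\alpha x^\alpha\in\mathbb{R}[x_1,\dots,x_n]$, $\operatorname{Supp}(f)=\{\alpha : c_\alpha\neq 0\}$ and $\operatorname{Newt}(f)$ is the convex hull of $\operatorname{Supp}(f)$. $f$ has saturated Newton polytope (SNP) if every point of $\operatorname{Newt}(f)\cap\mathbb{Z}^n$ is an exponent vector of $f$, i.e. lies in $\operatorname{Supp}(f)$. A partition in $\mathbb{R}^n$ is a vector $\lambda=(\lambda_1,\dots,\lambda_n)\in\mathbb{Z}^n$ with $\lambda_1\geq\cdots\geq\lambda_n\geq 0$ (trailing zeros allowed); its size is the sum of its entries, and partitions are added coordinatewise. The Schur polynomial is $s_\lambda=\sum_\alpha K_{\lambda,\alpha}x_1^{\alpha_1}\cdots x_n^{\alpha_n}$, where $K_{\lambda,\alpha}$ is the number of semistandard Young tableaux (rows weakly increasing,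 columns strictly increasing) of shape $\lambda$ and content $\alpha=(\alpha_1,\dots,\alpha_n)$, i.e. with $\alpha_i$ entries equal to $i$. For partitions $\lambda,\mu$ of the same size, $\lambda\trianglelefteq\mu$ (dominance order) means $\sum_{i=1}^k\lambda_i\leq\sum_{i=1}^k\mu_i$ for all $k$; partitions of different sizes are incomparable. For a symmetric polytope $\mathcal{P}$, $\operatorname{LP}(\mathcal{P})$ is the set of lattice points of $\mathcal{P}$ that are partitions, and $\operatorname{MLP}(\mathcal{P})$ is the set of $\trianglelefteq$-maximal elements of $\operatorname{LP}(\mathcal{P})$. Note that $ts$ is a new polynomial as defined in the claim, not the scalar multiple of $s$ by $t$. *)

(* Defs.v *)
From mathcomp Require Import all_boot all_order all_algebra all_fingroup.
From mathcomp Require Import boolp classical_sets reals.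
From mathcomp Require Export mpoly.

Set Implicit Arguments.
Unset Strict Implicit.
Unset Printing Implicit Defensive.

Import Order.TTheory GRing.Theory Num.Theory.

Local Open Scope classical_set_scope.
Local Open Scope ring_scope.

Section Polytopes.
Variables (R : realType) (n : nat).
Implicit Types (A P : set 'rV[R]_n) (z : 'rV[int]_n).

Definition convex_hull A : set 'rV[R]_n :=
  [set x | exists (m : nat) (w : 'I_m -> R) (p : 'I_m -> 'rV[R]_n),
    [/\ forall i, 0 <= w i, \sum_i w i = 1, forall i, A (p i)
      & x = \sum_i w i *: p i]].

Definition lattice_point z : 'rV[R]_n := map_mx intr z.

Definition lattice_polytope P : Prop :=
  exists2 s : seq 'rV[int]_n,
    s != [::] & P = convex_hull (lattice_point @` [set` s]).

Definition symmetric_polytope P : Prop :=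
  forall pi : 'S_n, col_perm pi @` P = P.

Definition nonneg_orthant : set 'rV[R]_n := [set x | forall i, 0 <= x 0 i].

Definition dilate (t : nat) P : set 'rV[R]_n := [set t%:R *: x | x in P].

Definition IDP P : Prop :=
  forall t : nat, (0 < t)%N ->
  forall z, dilate t P (lattice_point z) ->
  exists2 y : 'I_t -> 'rV[int]_n,
    forall i, P (lattice_point (y i)) & z = \sum_i y i.

End Polytopes.

Arguments lattice_point R {n} z.
Arguments nonneg_orthant R n : clear implicits.

Definition exponent_vector n (m : 'X_{1..n}) : 'rV[int]_n :=
  \row_i (m i)%:Z.

Section NewtonPolytope.
Variables (A : nzRingType) (n : nat).
Implicit Types f : {mpoly A[n]}.

Definition Supp f : set 'rV[int]_n := [set exponent_vector m | m in [set` msupp f]].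

Definition Newt (R : realType) f : set 'rV[R]_n :=
  convex_hull (lattice_point R @` Supp f).

Arguments Newt R f : clear implicits.

Definition SNP (R : realType) f : Prop :=
  forall z : 'rV[int]_n, Newt R f (lattice_point R z) -> Supp f z.

End NewtonPolytope.

Arguments Newt {A n} R f.
Arguments SNP {A n} R f.

(* Partitions are nonnegative, so they are taken in 'X_{1..n} rather than in
   Z^n; addition there is coordinatewise, and mdeg is the size. *)
Definition is_partition n (lam : 'X_{1..n}) : Prop :=
  forall i j : 'I_n, (i <= j)%N -> (lam j <= lam i)%N.

Definition dominated n (lam mu : 'X_{1..n}) : Prop :=
  mdeg lam = mdeg mu /\
  forall k : nat,
    (\sum_(i < n | (i < k)%N) lam i <= \sum_(i < n | (i < k)%N) mu i)%N.

Section Schur.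
Variable n : nat.
Implicit Types lam alpha : 'X_{1..n}.

(* Cells of the Young diagram: the pair (i, j) with j < lam i is the cell in
   row i and column j (both counted from 0). Entries 1, ..., n are shifted to
   0, ..., n - 1. *)
Definition cell lam : finType := {i : 'I_n & 'I_(lam i)}.
Definition tableau lam : finType := {ffun cell lam -> 'I_n}.

Definition semistandard lam (T : tableau lam) : bool :=
  [forall c : cell lam, forall d : cell lam,
    ((tag c == tag d) && (tagged c < tagged d)%N ==> (T c <= T d)%N) &&
    ((tag c < tag d)%N && (tagged c == tagged d :> nat) ==> (T c < T d)%N)].

Definition content lam (T : tableau lam) : 'X_{1..n} :=
  [multinom #|[set c | T c == i]%SET| | i < n].

Definition kostka lam alpha : nat :=
  #|[set T : tableau lam | semistandard T & content T == alpha]%SET|.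

(* kostka lam alpha = 0 unless mdeg alpha = mdeg lam, so the sum over all alpha
   is the sum over those of degree at most mdeg lam. *)
Definition schur lam : {mpoly int[n]} :=
  \sum_(alpha : 'X_{1..n < (mdeg lam).+1})
     (kostka lam alpha)%:R *: 'X_[alpha].

End Schur.

Section MaximalPartitions.
Variables (R : realType) (n : nat) (P : set 'rV[R]_n).

Definition LP : set 'X_{1..n} :=
  [set lam | is_partition lam /\ P (lattice_point R (exponent_vector lam))].

Definition MLP : set 'X_{1..n} :=
  [set lam | LP lam /\ forall mu, LP mu -> dominated lam mu -> mu = lam].

End MaximalPartitions.

Section MultisetSums.
Variables (n k : nat) (lam : 'I_k -> 'X_{1..n}).

Definition schur_sum : {mpoly int[n]} := \sum_(i < k) schur (lam i).

(* The multisubset in which i has multiplicity I i; multiplicities in a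
   multisubset of size t are at most t. *)
Definition multiset_sum (t : nat) (I : {ffun 'I_k -> 'I_t.+1}) : 'X_{1..n} :=
  (\sum_(i < k) lam i *+ I i)%MM.

Definition schur_multiple (t : nat) : {mpoly int[n]} :=
  \sum_(I : {ffun 'I_k -> 'I_t.+1} | (\sum_(i < k) I i)%N == t)
     schur (multiset_sum I).

End MultisetSums.

(* Main.v *)
Require Import Defs.
From mathcomp Require Import all_boot all_order all_algebra all_fingroup.
From mathcomp Require Import boolp classical_sets reals.
From mathcomp Require Import zify.

(** Saturation turns a lattice point [z] of [t P] into an exponent of the
    multiple of [s], hence into the content of a semistandard tableau [T] whose
    shape is a sum of [t] of the maximal partitions.  The idea is to cut [T]
    into its columns.  The columns of a diagram of shape [mu + nu] are, up to
    order, those of [mu] together with those of [nu]; and keeping only some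
    columns of a semistandard tableau, in their order, leaves a semistandard
    tableau.  So [T] splits into one tableau of each of the [t] shapes, and its
    content is the sum of their contents ([kostka_split], [kostka_split_sum]).
    Each of these contents is an exponent of [s], since Schur polynomials have
    nonnegative coefficients and nothing cancels in [s] ([msupp_sum_schurP]).
    Finally [Newt s = P], which is the hypothesis on dilates at [t = 1], so
    the contents are lattice points of [P] that add up to [z]. *)

Import Order.TTheory.

Local Open Scope classical_set_scope.

(** * Splitting the columns of a diagram *)

Section ColumnSplitting.
Variables (n : nat) (mu nu : 'X_{1..n}).
Implicit Types i j : nat.

(** The columns of [mu + nu] are sorted by decreasing height, the columns of
    [mu] coming before those of [nu] among columns of equal height.  Column [j]
    of [mu] is then preceded by its [j] predecessors in [mu] and by the columns
    of [nu] that are strictly taller.  As [mu r <= j] says that row [r] is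
    below column [j] of [mu], the number of those is the maximum taken here. *)
Definition lcol j : nat := j + \max_(r < n | mu r <= j) nu r.

(** Column [j] of [nu] is preceded by the columns of [mu] that are at least as
    tall, that is, which reach every row [r] with [j < nu r].  The default
    value [mdeg mu] of the minimum exceeds every column index of [mu], so that
    [lcol_neq_rcol] needs no condition on the column of [nu]. *)
Definition rcol j : nat :=
  j + \big[Order.min/mdeg mu]_(r < n | j < nu r) mu r.

Lemma lcol_mono j1 j2 : j1 < j2 -> lcol j1 < lcol j2.
Proof.
move=> lt12; rewrite /lcol -addSn leq_add //.
apply/bigmax_leqP => r le_r; apply: (leq_bigmax_cond (F := fun r => nu r)).
exact: leq_trans le_r (ltnW lt12).
Qed.

Lemma rcol_mono j1 j2 : j1 < j2 -> rcol j1 < rcol j2.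
Proof.
move=> lt12; rewrite /rcol -addSn leq_add // -leEnat.
apply: sub_bigmin => r; exact: ltn_trans.
Qed.

(** Both positions are compared with [j1 + j2].  A row [r] with [mu r <= j1]
    and [j2 < nu r] pushes [lcol j1] above [j1 + j2] and keeps [rcol j2] at or
    below it; if there is no such row, then [lcol j1 <= j1 + j2 < rcol j2]. *)
Lemma lcol_neq_rcol (i : 'I_n) j1 j2 : j1 < mu i -> lcol j1 != rcol j2.
Proof.
move=> lt_j1; rewrite /lcol /rcol.
have [/existsP[r /andP[le_r lt_r]]|] :=
  boolP [exists r : 'I_n, (mu r <= j1) && (j2 < nu r)].
  have le_max : nu r <= \max_(r < n | mu r <= j1) nu r.
    exact: (leq_bigmax_cond (F := fun r => nu r)).
  have le_min : \big[Order.min/mdeg mu]_(r < n | j2 < nu r) mu r <= mu r.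
    by rewrite -leEnat; apply: bigmin_le_cond.
  by lia.
rewrite negb_exists => /forallP no_r.
have le_max : \max_(r < n | mu r <= j1) nu r <= j2.
  apply/bigmax_leqP => r le_r.
  by have := no_r r; rewrite le_r /= -leqNgt.
have lt_min : j1 < \big[Order.min/mdeg mu]_(r < n | j2 < nu r) mu r.
  apply: (@lt_bigmin _ nat) => [|r lt_r]; rewrite ltEnat /=.
    by apply: leq_trans lt_j1 _; rewrite mdegE (bigD1 i) //= leq_addr.
  by have := no_r r; rewrite lt_r andbT -ltnNge.
by lia.
Qed.

(** A column of [nu] strictly taller than a column of [mu] that reaches row [i]
    also reaches row [i], so at most [nu i] columns of [nu] come before. *)
Lemma lcol_lt (i : 'I_n) j :
  is_partition nu -> is_partition mu -> j < mu i -> lcol j < (mu + nu)%MM i.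
Proof.
move=> pnu pmu lt_j; rewrite mnmDE /lcol -addSn leq_add //.
apply/bigmax_leqP => r le_r; apply: pnu; rewrite leqNgt; apply/negP => lt_ri.
by have := pmu _ _ (ltnW lt_ri); rewrite leqNgt (leq_ltn_trans le_r lt_j).
Qed.

Lemma rcol_lt (i : 'I_n) j : j < nu i -> rcol j < (mu + nu)%MM i.
Proof.
move=> lt_j; rewrite mnmDE /rcol addnC -addnS leq_add // -leEnat.
exact: bigmin_le_cond.
Qed.

End ColumnSplitting.

(** * Tableaux and Kostka numbers *)

Section Tableaux.
Variable n : nat.
Implicit Types (lam mu nu alpha : 'X_{1..n}).

Lemma card_cell lam : #|{: cell lam}| = mdeg lam.
Proof.
rewrite card_tagged sumnE big_map big_enum /= mdegE.
by apply: eq_bigr => i _; rewrite card_ord.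
Qed.

Lemma mdeg_content lam (T : tableau lam) : mdeg (content T) = mdeg lam.
Proof.
rewrite mdegE -card_cell -sum1_card.
rewrite (partition_big T predT) //=; apply: eq_bigr => i _.
by rewrite mnmE -sum1_card; apply: eq_bigl => c; rewrite inE.
Qed.

Lemma kostka_gt0P lam alpha :
  reflect (exists2 T : tableau lam, semistandard T & content T = alpha)
          (0 < kostka lam alpha).
Proof.
rewrite card_gt0; apply: (iffP (finset.set0Pn _)) => [[T]|[T sT cT]].
  by rewrite inE => /andP[sT /eqP cT]; exists T.
by exists T; rewrite inE sT cT eqxx.
Qed.

Lemma mdeg_kostka lam alpha : 0 < kostka lam alpha -> mdeg alpha = mdeg lam.
Proof. by move=> /kostka_gt0P[T _ <-]; apply: mdeg_content. Qed.

Section Restriction.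
Variables (lam mu : 'X_{1..n}) (f : nat -> nat).
Hypothesis f_mono : forall j1 j2, j1 < j2 -> f j1 < f j2.
Hypothesis f_lt : forall (i : 'I_n) j, j < mu i -> f j < lam i.

Definition move_cell (c : cell mu) : cell lam :=
  Tagged (fun i => 'I_(lam i)) (Ordinal (f_lt _ _ (ltn_ord (tagged c)))).

Definition restrict_columns (T : tableau lam) : tableau mu :=
  [ffun c => T (move_cell c)].

Lemma move_cell_inj : injective move_cell.
Proof.
move=> [i j] [i' j'] /= eq_c.
have eq_i : i = i' := congr1 tag eq_c; case: _ / eq_i j' eq_c => j' eq_c.
have eq_f : f j = f j' := congr1 (fun c : cell lam => tagged c : nat) eq_c.
congr (Tagged _ _); apply: val_inj => /=.
have [/f_mono|/f_mono|//] := ltngtP j j'; first by rewrite eq_f ltnn.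
by rewrite eq_f ltnn.
Qed.

(** Moving whole columns, without changing their order, keeps cells in their
    row and preserves both kinds of comparisons. *)
Lemma restrict_columns_semistandard T :
  semistandard T -> semistandard (restrict_columns T).
Proof.
move=> /forallP ssT; apply/forallP => c; apply/forallP => d.
have /forallP/(_ (move_cell d)) /= /andP[rowT colT] := ssT (move_cell c).
rewrite !ffunE; apply/andP; split.
  by apply/implyP => /andP[eq_cd /f_mono lt_cd]; rewrite eq_cd lt_cd in rowT.
by apply/implyP => /andP[lt_cd /eqP eq_cd]; rewrite lt_cd eq_cd eqxx in colT.
Qed.

End Restriction.

(** Any tableau of shape [mu + nu] is cut along the positions [lcol] and [rcol],
    which together use every cell exactly once. *)
Lemma kostka_split mu nu alpha :
    is_partition mu -> is_partition nu -> 0 < kostka (mu + nu) alpha ->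
  exists beta gamma, [/\ alpha = (beta + gamma)%MM,
    0 < kostka mu beta & 0 < kostka nu gamma].
Proof.
move=> pmu pnu /kostka_gt0P[T ssT <-].
pose l_lt i j := @lcol_lt _ mu nu i j pnu pmu.
pose r_lt i j := @rcol_lt _ mu nu i j.
pose lT := restrict_columns _ _ _ l_lt T.
pose rT := restrict_columns _ _ _ r_lt T.
pose h (c : cell mu + cell nu) : cell (mu + nu)%MM :=
  match c with
  | inl c => move_cell _ _ _ l_lt c
  | inr c => move_cell _ _ _ r_lt c
  end.
have neq_h c d : h (inl c) <> h (inr d).
  move=> /(congr1 (fun c : cell (mu + nu)%MM => tagged c : nat)) /eqP.
  exact/negP/lcol_neq_rcol/ltn_ord.
have h_inj : injective h.
  case=> [c|c] [d|d] eq_h; last 1 first.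
  - by congr inr; apply: move_cell_inj eq_h; apply: rcol_mono.
  - by congr inl; apply: move_cell_inj eq_h; apply: lcol_mono.
  - by case: (neq_h c d).
  - by case: (neq_h d c).
(* The row lengths of [mu] and [nu] add up, so injectivity is enough. *)
have h_bij : bijective h.
  by apply: inj_card_bij => //; rewrite card_sum !card_cell mdegD.
exists (content lT), (content rT); split.
- apply/mnmP => v; rewrite mnmDE !mnmE -!sum1dep_card.
  rewrite (reindex h) /=; last exact: onW_bij.
  rewrite big_sumType /=; congr (_ + _).
    by apply: eq_bigl => c; rewrite ffunE.
  by apply: eq_bigl => c; rewrite ffunE.
- apply/kostka_gt0P; exists lT => //.
  by apply: restrict_columns_semistandard ssT; apply: lcol_mono.
- apply/kostka_gt0P; exists rT => //.
  by apply: restrict_columns_semistandard ssT; apply: rcol_mono.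
Qed.

Lemma is_partition_sum (I : finType) (mu : I -> 'X_{1..n}) :
  (forall i, is_partition (mu i)) -> is_partition (\sum_i mu i)%MM.
Proof.
by move=> pmu i j le_ij; rewrite !mnm_sumE; apply: leq_sum => x _; apply: pmu.
Qed.

Lemma kostka_split_sum t (mu : 'I_t -> 'X_{1..n}) alpha :
    (forall j, is_partition (mu j)) -> 0 < kostka (\sum_j mu j) alpha ->
  exists2 beta : 'I_t -> 'X_{1..n},
    alpha = (\sum_j beta j)%MM & forall j, 0 < kostka (mu j) (beta j).
Proof.
elim: t mu alpha => [|t IHt] mu alpha pmu.
  rewrite big_ord0 => /mdeg_kostka/eqP; rewrite mdeg0 mdeg_eq0 => /eqP->.
  by exists (fun=> 0%MM) => [|[]//]; rewrite big_ord0.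
rewrite big_ord_recl => /kostka_split[//||b [g [-> kb /IHt[//|beta -> kbeta]]]].
  by apply: is_partition_sum.
exists (fun j => oapp beta b (unlift ord0 j)).
  rewrite big_ord_recl unlift_none /=; congr (_ + _)%MM.
  by apply: eq_bigr => j _; rewrite liftK.
by move=> j; case: unliftP => [j'|] -> /=.
Qed.

End Tableaux.

(** * Exponents of sums of Schur polynomials *)

Section SchurSupport.
Variable n : nat.
Local Open Scope ring_scope.
Import GRing.Theory Num.Theory.

Lemma mcoeff_schur (lam alpha : 'X_{1..n}) :
  (schur lam)@_alpha = (kostka lam alpha)%:R.
Proof.
rewrite /schur raddf_sum /=.
under eq_bigr do rewrite mcoeffZ mcoeffX.
have [lt_a|ge_a] := ltnP (mdeg alpha) (mdeg lam).+1.
  rewrite (bigD1 (BMultinom lt_a)) //= eqxx mulr1 big1 ?addr0 // => b ne_b.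
  by rewrite -[alpha]/(bmnm (BMultinom lt_a)) -val_eqE /= in ne_b *;
     rewrite (negbTE ne_b) mulr0.
rewrite big1 => [|b _].
  case: (posnP (kostka lam alpha)) => [-> //|/mdeg_kostka eq_a].
  by rewrite eq_a ltnn in ge_a.
case: eqP => [eq_b|_]; last by rewrite mulr0.
by have := bmdeg b; rewrite eq_b ltnNge ge_a.
Qed.

(** Coefficients of Schur polynomials are nonnegative, so that exponents cannot
    cancel in a sum. *)
Lemma msupp_sum_schurP (I : finType) (p : pred I) (mu : I -> 'X_{1..n}) alpha :
  reflect (exists2 i, p i & (0 < kostka (mu i) alpha)%N)
          (alpha \in msupp (\sum_(i | p i) schur (mu i))).
Proof.
rewrite mcoeff_msupp raddf_sum /=.
under eq_bigr do rewrite mcoeff_schur.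
rewrite -natr_sum pnatr_eq0 sum_nat_eq0 negb_forall.
apply: (iffP existsP) => [[i]|[i pi ki]].
  by rewrite negb_imply -lt0n => /andP[]; exists i.
by exists i; rewrite negb_imply pi -lt0n.
Qed.

End SchurSupport.

Lemma multiset_sum_enum n k (lam : 'I_k -> 'X_{1..n}) t
    (I : {ffun 'I_k -> 'I_t.+1}) :
    (\sum_(i < k) I i)%N = t ->
  exists f : 'I_t -> 'I_k, multiset_sum lam I = (\sum_j lam (f j))%MM.
Proof.
move=> sumI; pose s := flatten [seq nseq (I i) i | i <- enum 'I_k].
have size_s : size s = t.
  rewrite size_flatten /shape -map_comp sumnE big_map big_enum /= -[RHS]sumI.
  by apply: eq_bigr => i _; rewrite size_nseq.
exists (tnth (Tuple (introT eqP size_s))).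
rewrite -(big_tuple _ _ _ xpredT lam) /= big_flatten big_map.
rewrite big_enum /=; apply: eq_bigr => i _; rewrite big_nseq.
by elim: (nat_of_ord (I i)) => [|m IHm]; rewrite ?mulm0n //= -IHm mulmS.
Qed.

(** * Polytopes *)

Section Polytopes.
Variables (R : realType) (n : nat).
Local Open Scope ring_scope.
Import GRing.Theory Num.Theory.

Lemma sub_convex_hull (A : set 'rV[R]_n) : A `<=` convex_hull A.
Proof.
move=> x Ax; exists 1%N, (fun=> 1), (fun=> x).
by split; rewrite ?big_ord1 ?scale1r.
Qed.

Lemma dilate1 (A : set 'rV[R]_n) : dilate 1 A = A.
Proof.
apply/seteqP; split => [_ [x Ax <-]|x Ax]; first by rewrite scale1r.
by exists x; rewrite ?scale1r.
Qed.

Lemma exponent_vector_sum (I : finType) (m : I -> 'X_{1..n}) :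
  exponent_vector (\sum_i m i)%MM = \sum_i exponent_vector (m i).
Proof.
apply/rowP => j; rewrite summxE mxE mnm_sumE (big_morph Posz PoszD erefl).
by apply: eq_bigr => i _; rewrite mxE.
Qed.

End Polytopes.

Theorem theorem3p5 (R : realType) (n : nat) (P : set 'rV[R]_n)
    (hlat : lattice_polytope P) (hsym : symmetric_polytope P)
    (hpos : P `<=` nonneg_orthant R n)
    (k : nat) (lam : 'I_k -> 'X_{1..n})
    (hinj : injective lam) (hlam : MLP P = range lam)
    (hNewt : forall t : nat, (0 < t)%N ->
       Newt R (schur_multiple lam t) = dilate t (Newt R (schur_sum lam)) /\
       dilate t P = Newt R (schur_multiple lam t))
    (hSNP : forall t : nat, (0 < t)%N -> SNP R (schur_multiple lam t)) :
  IDP P.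
Proof.
have PE : P = Newt R (schur_sum lam).
  by have [e1 e2] := hNewt 1 isT; rewrite -[P]dilate1 e2 e1 dilate1.
have plam i : is_partition (lam i).
  by have [[]] : MLP P (lam i) by rewrite hlam; exists i.
move=> t t0 z; have [_ ->] := hNewt t t0.
move=> /(hSNP t t0)[alpha /= /msupp_sum_schurP[I /eqP sumI kI] <-].
have [f fE] := multiset_sum_enum _ _ lam _ _ sumI.
rewrite {}fE in kI.
have [beta -> kbeta] := kostka_split_sum _ _ _ _ (fun j => plam (f j)) kI.
exists (fun j => exponent_vector (beta j)); last exact: exponent_vector_sum.
move=> j; rewrite PE; apply: sub_convex_hull.
exists (exponent_vector (beta j)) => //; exists (beta j) => //=.
by apply/msupp_sum_schurP; exists (f j).
Qed.
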